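(* Let $n\ge1$ be an integer and, for $j=0,\dots,n$, let $f_{2j+1}$ be a homogeneous polynomial of degree $2j+1$ with complex coefficients in the four entries of a $2\times2$ matrix, not divisible by $\det$ (viewed as a degree-$2$ polynomial). Let $S_{2n+1}\subset\mathbb{K}P^3$ be the surface defined by $F_{2n+1}(A)=0$, where $$F_{2n+1}(A)=\sum_{j=0}^n t^{-j(j+1)}(\det A)^{n-j}f_{2j+1}(A).$$ Let $C_{2j+1}=\{[B]_{\mathbb{C}^*}\in Q(\mathbb{C}): f_{2j+1}(B)=0\}$, and let $H=\{[B]_{\mathbb{C}^*}\in\mathbb{C}P^3: f_1(B)=0,\ \det B\neq0\}$. For $j=1,\dots,n$ let $\sigma_j$ be the section of $\mathcal{S}$ over $Q(\mathbb{C})\setminus(C_{2j-1}\cup C_{2j+1})$ given by $\sigma_j([B]_{\mathbb{C}^*})=\left[\sqrt{-\tfrac{f_{2j-1}(B)}{f_{2j+1}(B)}}\,B\right]_{\mathbb{R}^*}$. Then $$\operatorname{VAL}(S_{2n+1})\subset\Sigma_\infty\cup\Sigma_R\cup\Sigma_C\cup\Sigma_0,$$ where $\Sigma_\infty=\{\infty\}\times C_{2n+1}$, $\Sigma_R=\bigcup_{j=0}^{n-1}((j,j+1)\cap\mathbb{Q})\times\mathcal{S}|_{C_{2j+1}}\ \cup\ ((n,\infty)\cap\mathbb{Q})\times\mathcal{S}|_{C_{2n+1}}$, $\Sigma_C=\bigcup_{j=1}^n\{j\}\times\Big(\sigma_j\big(Q(\mathbb{C})\setminus(C_{2j-1}\cup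 C_{2j+1})\big)\cup\mathcal{S}|_{C_{2j-1}\cap C_{2j+1}}\Big)$, and $\Sigma_0=\{0\}\times\varkappa^\circ(H)$.
   Context: Matrices and classes. For a $2\times 2$ matrix $B=\begin{pmatrix}a&b\\ c&d\end{pmatrix}$ write $B^{\mathbf c}=\begin{pmatrix}d&-b\\ -c&a\end{pmatrix}$; $B^*$ is the conjugate transpose. $\mathbb{C}P^3$ is the projectivization of the space of complex $2\times2$ matrices; $[B]_{\mathbb{C}^*}$ is the class of a nonzero matrix up to nonzero complex scalars, $[B]_{\mathbb{R}^*}$ its class up to nonzero real scalars. $Q(\mathbb{C})=\{[B]_{\mathbb{C}^*}:\det B=0\}$, $PSL_2(\mathbb{C})=\mathbb{C}P^3\setminus Q(\mathbb{C})$, $PSU(2)=\{[U]_{\mathbb{C}^*}:U\in SU(2)\}$. The spherical coamoeba map $\varkappa^\circ\colon PSL_2(\mathbb{C})\to PSU(2)$ sends $[A]_{\mathbb{C}^*}$ with $\det A=1$ to $[A+(A^{\mathbf c})^*]_{\mathbb{R}^*}$ (the class of the unitary factor of the polar decomposition of $A$). Circle bundle. $\mathcal{S}$ is the set of classes $[B]_{\mathbb{R}^*}$ of complex $2\times2$ matrices of rank one, with projection $\pi\colon\mathcal{S}\to Q(\mathbb{C})$, $[B]_{\mathbb{R}^*}\mapsto[B]_{\mathbb{C}^*}$; for $Z\subset Q(\mathbb{C})$, $\mathcal{S}|_Z=\pi^{-1}(Z)$; a section over $Z$ is a map $\sigma\colon Z\to\mathcal{S}$ with $\pi\circ\sigma=\mathrm{id}_Z$.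 Cone notation (subsets of $\mathbb{C}P^3$). For $I\subset(0,\infty)$ and $T\subset\mathcal{S}$, $I\times T:=\{[e^\alpha B+e^{-\alpha}(B^{\mathbf c})^*]_{\mathbb{C}^*}:\alpha\in I,\ [B]_{\mathbb{R}^*}\in T\}$; for $X\subset PSU(2)$, $\{0\}\times X:=X$; for $Y\subset Q(\mathbb{C})$, $\{\infty\}\times Y:=Y$. Field and valuation. $\mathbb{K}$ is the field of Puiseux series in $t$ (with $t\to\infty$) with complex coefficients, i.e. series $\sum_q a_q t^q$ with $a_q\in\mathbb{C}$ and exponents in $\frac1N\mathbb{Z}$ for some $N\ge1$, bounded above. $\mathbb{K}P^3$ is the projectivization of the space of $2\times 2$ matrices over $\mathbb{K}$. Every nonzero matrix $A$ over $\mathbb{K}$ can be written uniquely as $A=t^\alpha B+(\text{terms with exponents}<\alpha)$ with $\alpha\in\mathbb{Q}$ and $B$ a nonzero complex matrix. The map $\operatorname{VAL}\colon\mathbb{K}P^3\to\mathbb{C}P^3$ is: if $\det A=0$, $\operatorname{VAL}([A])=[B]_{\mathbb{C}^*}$; if $\det A\ne0$, rescale $A$ so that $\det A=1$ (then $\alpha\ge0$), and set $\operatorname{VAL}([A])=[e^\alpha B+e^{-\alpha}(B^{\mathbf c})^*]_{\mathbb{C}^*}$. *)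

(* Defs.v *)
From HB Require Import structures.
From mathcomp Require Import all_boot all_order all_algebra.
From mathcomp Require Import complex Rstruct mpoly.
From Stdlib Require Rtrigo_def.

Set Implicit Arguments.
Unset Strict Implicit.
Unset Printing Implicit Defensive.

Import Order.TTheory GRing.Theory Num.Theory.
Local Open Scope ring_scope.

Definition Rr : rcfType := Rdefinitions.R.
Definition C : numClosedFieldType := Rr[i].
Definition rC (x : Rr) : C := Complex x 0.

Definition eexp (a : rat) : C := rC (Rtrigo_def.exp (ratr a)).

(* B^c = [[d,-b],[-c,a]] for B = [[a,b],[c,d]] *)
Definition cmx (B : 'M[C]_2) : 'M[C]_2 :=
  \matrix_(i < 2, j < 2) (if i == j then B (rev_ord i) (rev_ord j) else - B i j).

Definition mstar (B : 'M[C]_2) : 'M[C]_2 := \matrix_(i < 2, j < 2) (B j i)^*.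

Definition cone_pt (a : rat) (B : 'M[C]_2) : 'M[C]_2 :=
  eexp a *: B + eexp (- a) *: mstar (cmx B).

(* Polynomials in the four entries: variable k <-> entry (k/2, k mod 2),
   i.e. X_0 = a, X_1 = b, X_2 = c, X_3 = d for B = [[a,b],[c,d]]. *)
Definition vec_of (B : 'M[C]_2) : 'I_4 -> C :=
  fun k => B (inord (k %/ 2)) (inord (k %% 2)).

Definition evalC (f : {mpoly C[4]}) (B : 'M[C]_2) : C := f.@[vec_of B].

Definition detP : {mpoly C[4]} :=
  'X_(@inord 3 0) * 'X_(@inord 3 3) - 'X_(@inord 3 1) * 'X_(@inord 3 2).

Definition homog_deg (d : nat) (f : {mpoly C[4]}) : Prop :=
  forall m, m \in msupp f -> mdeg m = d.

Definition dvd_det (f : {mpoly C[4]}) : Prop :=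
  exists g : {mpoly C[4]}, f = detP * g.

(* Puiseux series in t (t -> oo) with complex coefficients             *)
(* A representation PSer N' top c denotes the series                   *)
(*     sum_{k >= 0} c k * t^((top - k) / (N'+1)).                       *)
(* Every Puiseux series has such a representation; the series itself   *)
(* is its coefficient function pcoefAt : rat -> C.                      *)

Record pser := PSer { pden : nat; ptop : int; pcoef : nat -> C }.

Definition pN (x : pser) : nat := (pden x).+1.

Definition pcoefAt (x : pser) (q : rat) : C :=
  let m := q * (pN x)%:R in
  if (denq m == 1) && (numq m <= ptop x)
  then pcoef x `|ptop x - numq m|%N else 0.

Definition pzero (x : pser) : Prop := forall q, pcoefAt x q = 0.
Definition peq (x y : pser) : Prop := forall q, pcoefAt x q = pcoefAt y q.

Definition pexp (top : int) (N k : nat) : rat := (top - k%:Z)%:~R / N%:R.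

Definition pconst (c : C) : pser := PSer 0 0 (fun k => if k == 0%N then c else 0).
Definition p0 : pser := pconst 0.
Definition pone : pser := pconst 1.

Definition ptpow (q : rat) : pser :=
  PSer (`|denq q|%N).-1 (numq q) (fun k => if k == 0%N then 1 else 0).

Definition pneg (x : pser) : pser := PSer (pden x) (ptop x) (fun k => - pcoef x k).

Definition padd (x y : pser) : pser :=
  let N := (pN x * pN y)%N in
  let top := Num.max (ptop x * (pN y)%:Z) (ptop y * (pN x)%:Z) in
  PSer N.-1 top (fun k => pcoefAt x (pexp top N k) + pcoefAt y (pexp top N k)).

Definition pmul (x y : pser) : pser :=
  let N := (pN x * pN y)%N in
  let tx := ptop x * (pN y)%:Z in
  let ty := ptop y * (pN x)%:Z in
  PSer N.-1 (tx + ty)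
    (fun k => \sum_(i < k.+1)
        pcoefAt x (pexp tx N i) * pcoefAt y (pexp ty N (k - i))).

Definition ppow (x : pser) (k : nat) : pser := iter k (pmul x) pone.

Definition psum (s : seq pser) : pser := foldr padd p0 s.

Definition peval (f : {mpoly C[4]}) (a : 'I_4 -> pser) : pser :=
  psum [seq pmul (pconst f@_m)
              (foldr pmul pone [seq ppow (a i) (m i) | i <- enum 'I_4])
       | m <- msupp f].

Definition KMat := 'I_2 -> 'I_2 -> pser.

Definition kvec (A : KMat) : 'I_4 -> pser :=
  fun k => A (inord (k %/ 2)) (inord (k %% 2)).

Definition pdet (A : KMat) : pser :=
  padd (pmul (A 0 0) (A 1 1)) (pneg (pmul (A 0 1) (A 1 0))).

Definition kscale (lam : pser) (A : KMat) : KMat := fun i j => pmul lam (A i j).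

Definition knonzero (A : KMat) : Prop := exists i j, ~ pzero (A i j).

(* F_{2n+1}(A) = sum_{j=0}^n t^{-j(j+1)} (det A)^{n-j} f_{2j+1}(A),
   where f j stands for f_{2j+1} *)
Definition Fpol (n : nat) (f : nat -> {mpoly C[4]}) (A : KMat) : pser :=
  psum [seq pmul (ptpow (- ((j * j.+1)%N)%:R))
             (pmul (ppow (pdet A) (n - j)) (peval (f j) (kvec A)))
       | j <- iota 0 n.+1].

Definition lead_term (A : KMat) (a : rat) (B : 'M[C]_2) : Prop :=
  B != 0 /\ (forall i j, pcoefAt (A i j) a = B i j) /\
  (forall i j q, a < q -> pcoefAt (A i j) q = 0).

(* "VAL([A]) = [M]_{C^*} for some M with P M".  Membership of the point
   VAL([A]) of CP^3 in a set Sigma is stated as P M where M is any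
   representative produced by the definition of VAL, P being invariant
   under nonzero complex scalars. *)
Definition VAL_in (P : 'M[C]_2 -> Prop) (A : KMat) : Prop :=
  (pzero (pdet A) -> forall a B, lead_term A a B -> P B) /\
  (~ pzero (pdet A) ->
     forall lam : pser, peq (pdet (kscale lam A)) pone ->
     forall a B, lead_term (kscale lam A) a B -> P (cone_pt a B)).

(* The sets Sigma (as subsets of CP^3, via C^*-invariant predicates)   *)

(* B nonzero of rank one: [B]_{C^*} in Q(C) / [B]_{R^*} in S *)
Definition rank1 (B : 'M[C]_2) : Prop := B != 0 /\ \det B = 0.

(* [M]_{C^*} in I x T, with I a set of rationals and T a set of R^*-classes
   of rank-one matrices given by a predicate on representatives *)
Definition cone (I : rat -> Prop) (T : 'M[C]_2 -> Prop) (M : 'M[C]_2) : Prop :=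
  exists a : rat, I a /\ exists B, rank1 B /\ T B /\
  exists mu : C, mu != 0 /\ M = mu *: cone_pt a B.

Section Sigmas.
Variables (n : nat) (f : nat -> {mpoly C[4]}).

Definition curve (j : nat) (B : 'M[C]_2) : Prop := rank1 B /\ evalC (f j) B = 0.

(* [B']_{R^*} in sigma_j(Q(C) \ (C_{2j-1} u C_{2j+1})) *)
Definition sigma_img (j : nat) (B' : 'M[C]_2) : Prop :=
  exists B, rank1 B /\ evalC (f j.-1) B != 0 /\ evalC (f j) B != 0 /\
  exists s : C, s ^+ 2 = - (evalC (f j.-1) B / evalC (f j) B) /\
  exists r : Rr, r != 0 /\ B' = rC r *: (s *: B).

Definition Sigma_inf (M : 'M[C]_2) : Prop :=
  exists mu : C, mu != 0 /\ exists B, curve n B /\ M = mu *: B.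

Definition Sigma_R (M : 'M[C]_2) : Prop :=
  (exists j, (j < n)%N /\
     cone (fun a => j%:R < a < j.+1%:R) (curve j) M) \/
  cone (fun a => n%:R < a) (curve n) M.

Definition Sigma_C (M : 'M[C]_2) : Prop :=
  exists j, (1 <= j <= n)%N /\
    cone (fun a => a = j%:R)
         (fun B => sigma_img j B \/ (curve j.-1 B /\ curve j B)) M.

Definition Sigma_0 (M : 'M[C]_2) : Prop :=
  exists B, \det B != 0 /\ evalC (f 0) B = 0 /\
  exists A, (exists nu : C, nu != 0 /\ A = nu *: B) /\ \det A = 1 /\
  exists mu : C, mu != 0 /\ M = mu *: (A + mstar (cmx A)).

End Sigmas.

(* Main.v *)
(** Rescale [A] by a Puiseux series so that [det A = 1], and write its leading
    term as [t^a B].  The [j]-th summand of [F_{2n+1}(A)] then has order at most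
    [e_j = (2j+1) a - j(j+1)], with coefficient [f_{2j+1}(B)] at [t^{e_j}].
    Since [e_j - e_i = (j-i)(2a-i-j-1)], the maximum of the [e_j] is attained
    once, at [j], if [j < a < j+1] (or [n < a] for [j = n], or [a = 0] for
    [j = 0]), which forces [f_{2j+1}(B) = 0]; for [a = j >= 1] it is attained at
    [j-1] and [j] only, which forces [f_{2j-1}(B) + f_{2j+1}(B) = 0].  Comparing
    coefficients in [det A = 1] gives [a >= 0], with [det B = 1] if [a = 0] and
    [det B = 0] otherwise. *)

Require Import Defs.
From HB Require Import structures.
From mathcomp Require Import all_boot all_order all_algebra.
From mathcomp Require Import complex Rstruct mpoly.
From mathcomp Require Import zify ring lra.
From Stdlib Require Import Classical.

Set Implicit Arguments.
Unset Strict Implicit.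
Unset Printing Implicit Defensive.

Import Order.TTheory GRing.Theory Num.Theory.
Local Open Scope ring_scope.

(** * Exponent grids of Puiseux representations *)

Lemma pexp_mulK (top : int) (N k : nat) : (0 < N)%N ->
  pexp top N k * N%:R = (top - k%:Z)%:~R.
Proof. by move=> N0; rewrite /pexp mulfVK // pnatr_eq0 -lt0n. Qed.

Lemma pexpP (top : int) (N : nat) (q : rat) (k : nat) : (0 < N)%N ->
  q * N%:R = (top - k%:Z)%:~R -> q = pexp top N k.
Proof. by move=> N0 e; rewrite /pexp -e mulfK // pnatr_eq0 -lt0n. Qed.

Lemma pexp_inj (top : int) (N : nat) : (0 < N)%N -> injective (pexp top N).
Proof.
move=> N0 i j e; have := pexp_mulK top i N0.
rewrite e (pexp_mulK top j N0) => /eqP; rewrite eqr_int => /eqP; lia.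
Qed.

Lemma pexp_refine (top : int) (N M k : nat) : (0 < M)%N ->
  pexp top N k = pexp (top * M%:Z) (N * M) (k * M).
Proof.
move=> M0; rewrite /pexp PoszM -mulrBl intrM natrM pmulrn invfM mulrACA divff ?mulr1 //.
by rewrite intr_eq0; lia.
Qed.

Lemma pexp_shift (top top' : int) (N k : nat) : top <= top' ->
  pexp top N k = pexp top' N (k + `|top' - top|).
Proof. by move=> le; rewrite /pexp; congr (_%:~R / _); lia. Qed.

Lemma pcoefAt_pexp (x : pser) (k : nat) :
  pcoefAt x (pexp (ptop x) (pN x) k) = pcoef x k.
Proof.
rewrite /pcoefAt pexp_mulK // denq_int numq_int eqxx /= ifT; last lia.
by congr pcoef; lia.
Qed.

(** The test in [pcoefAt] singles out the grid [pexp (ptop x) (pN x)]: on it the stored coefficient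
    is read, off it the default 0. *)
Lemma pcoefAt_cases (x : pser) (q : rat) :
  (exists k, q = pexp (ptop x) (pN x) k /\ pcoefAt x q = pcoef x k) \/
  ((forall k, q <> pexp (ptop x) (pN x) k) /\ pcoefAt x q = 0).
Proof.
have [[k e]|no] := classic (exists k, q = pexp (ptop x) (pN x) k).
  by left; exists k; split=> //; rewrite e pcoefAt_pexp.
right; split=> [k e|]; first by apply: no; exists k.
rewrite /pcoefAt; case: ifP => // /andP[/ratArchimedean.intrP[m e]].
rewrite e numq_int => le; case: no; exists `|ptop x - m|%N.
by apply: pexpP => //; rewrite e; congr _%:~R; lia.
Qed.

Lemma pcoefAt_neq0 (x : pser) (q : rat) : pcoefAt x q != 0 ->
  exists k, q = pexp (ptop x) (pN x) k.
Proof.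
by case: (pcoefAt_cases x q) => [[k [e _]] _|[_ ->]]; [exists k|rewrite eqxx].
Qed.

(** Serves to put two series with different denominators on the common grid used by [padd] and
    [pmul]. *)
Lemma pcoefAt_refine (x : pser) (M : nat) (top : int) (q : rat) :
  (0 < M)%N -> ptop x * M%:Z <= top -> pcoefAt x q != 0 ->
  exists k, q = pexp top (pN x * M) k.
Proof.
move=> M0 le /pcoefAt_neq0[k ->].
by rewrite (pexp_refine _ _ _ M0) (pexp_shift _ _ le); eexists.
Qed.

Lemma pcoefAt_top (x : pser) (q : rat) :
  pcoefAt x q != 0 -> q <= pexp (ptop x) (pN x) 0.
Proof.
move=> /pcoefAt_neq0[k ->]; rewrite /pexp ler_pM2r ?invr_gt0 ?ltr0n //.
by rewrite ler_int; lia.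
Qed.

Lemma pN_PSer (N : nat) top c : (0 < N)%N -> pN (PSer N.-1 top c) = N.
Proof. by case: N. Qed.

(** * Coefficients of sums and Cauchy products *)

Lemma pcoefAt_padd (x y : pser) (q : rat) :
  pcoefAt (padd x y) q = pcoefAt x q + pcoefAt y q.
Proof.
have N0 : (0 < pN x * pN y)%N by [].
case: (pcoefAt_cases (padd x y) q) => [[k]|].
  by rewrite [pN _]pN_PSer //= => -[<-].
rewrite [pN _]pN_PSer //= => -[no ->].
have [->|xq] := eqVneq (pcoefAt x q) 0; last first.
  have [|k e] := @pcoefAt_refine x (pN y) (ptop (padd x y)) q isT _ xq.
    by rewrite /= le_max lexx.
  by case: (no k).
have [->|yq] := eqVneq (pcoefAt y q) 0; last first.
  have [|k e] := @pcoefAt_refine y (pN x) (ptop (padd x y)) q isT _ yq.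
    by rewrite /= le_max lexx orbT.
  by case: (no k); rewrite mulnC.
by rewrite addr0.
Qed.

(** Any such finite list can index the convolution at [q], which frees products from the choice of
    denominators and tops. *)
Definition conv_cover (x y : pser) (q : rat) (s : seq rat) :=
  uniq s /\ forall u, pcoefAt x u * pcoefAt y (q - u) != 0 -> u \in s.

Lemma eq_sum_cover (F : rat -> C) (s s' : seq rat) :
  uniq s -> uniq s' -> (forall u, F u != 0 -> u \in s) ->
  (forall u, F u != 0 -> u \in s') -> \sum_(u <- s) F u = \sum_(u <- s') F u.
Proof.
move=> us us' cs cs'.
rewrite -(big_rmcond_in (fun u => F u != 0)) /=; last by move=> u _ /negPn/eqP.
rewrite -[RHS](big_rmcond_in (fun u => F u != 0)) /=; last by move=> u _ /negPn/eqP.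
rewrite -big_filter -[RHS]big_filter; apply: perm_big; apply: uniq_perm.
- exact: filter_uniq.
- exact: filter_uniq.
move=> u; rewrite !mem_filter; case: (boolP (F u != 0)) => //= nz.
by rewrite cs ?cs'.
Qed.

(** If [q] is the [k]-th point of the product grid, the first [k.+1] points of the refined grid of
    [x] form a cover; if [q] is off that grid, nothing contributes and the empty list does. *)
Lemma pcoefAt_pmul_cover (x y : pser) (q : rat) : exists s, conv_cover x y q s /\
  pcoefAt (pmul x y) q = \sum_(u <- s) pcoefAt x u * pcoefAt y (q - u).
Proof.
have N0 : (0 < pN x * pN y)%N by [].
set N := (pN x * pN y)%N in N0.
set tx := ptop x * (pN y)%:Z; set ty := ptop y * (pN x)%:Z.
have supp u : pcoefAt x u * pcoefAt y (q - u) != 0 ->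
    exists i j, u = pexp tx N i /\ q - u = pexp ty N j.
  rewrite mulf_eq0 negb_or => /andP[xu yu].
  have [i ei] := @pcoefAt_refine x (pN y) tx u isT (lexx _) xu.
  have [j ej] := @pcoefAt_refine y (pN x) ty _ isT (lexx _) yu.
  by exists i, j; rewrite ei; split=> //; rewrite -ei ej [in RHS]/N mulnC.
have pexpD i j : pexp tx N i + pexp ty N j = pexp (tx + ty) N (i + j).
  by rewrite /pexp -mulrDl -intrD; congr (_%:~R / _); lia.
case: (pcoefAt_cases (pmul x y) q) => [[k]|]; rewrite [pN _]pN_PSer //= -/N -/tx -/ty.
  move=> [e ->]; exists [seq pexp tx N i | i <- iota 0 k.+1]; split; first split.
  - by rewrite map_inj_uniq ?iota_uniq //; exact: (pexp_inj N0).
  - move=> u /supp[i [j [ui uj]]]; apply/mapP; exists i => //.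
    have /(pexp_inj N0) : pexp (tx + ty) N (i + j) = pexp (tx + ty) N k.
      by rewrite -pexpD -ui -uj -e addrC subrK.
    by rewrite mem_iota; lia.
  rewrite big_map -[iota 0 _]/(index_iota 0 k.+1) big_mkord; apply: eq_bigr => i _.
  congr (_ * pcoefAt y _); apply: (addrI (pexp tx N i)).
  by rewrite pexpD subnKC ?subrKC ?e // -ltnS.
move=> [no ->]; exists [::]; rewrite big_nil; do 2!split=> //.
move=> u /supp[i [j [ui uj]]]; case: (no (i + j)%N).
by rewrite -pexpD -ui -uj addrC subrK.
Qed.

Lemma pcoefAt_pmul (x y : pser) (q : rat) (s : seq rat) : conv_cover x y q s ->
  pcoefAt (pmul x y) q = \sum_(u <- s) pcoefAt x u * pcoefAt y (q - u).
Proof.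
move=> [us cs]; have [s' [[us' cs'] ->]] := pcoefAt_pmul_cover x y q.
exact: eq_sum_cover.
Qed.

(** * Ring laws up to equality of coefficients *)

Lemma peq_pmul {x x' y y' : pser} : peq x x' -> peq y y' -> peq (pmul x y) (pmul x' y').
Proof.
move=> ex ey q; have [s [[us cs] ->]] := pcoefAt_pmul_cover x y q.
rewrite (@pcoefAt_pmul _ _ _ s); last by split=> // u; rewrite -ex -ey => /cs.
by apply: eq_bigr => u _; rewrite ex ey.
Qed.

Lemma peq_sym {x y : pser} : peq x y -> peq y x.
Proof. by move=> e q. Qed.

Lemma peq_trans {x y z : pser} : peq x y -> peq y z -> peq x z.
Proof. by move=> e e' q; rewrite e. Qed.

Lemma pmulC (x y : pser) : peq (pmul x y) (pmul y x).
Proof.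
move=> q; have [s [[us cs] ->]] := pcoefAt_pmul_cover x y q.
have invol : injective (fun u : rat => q - u) by move=> u v /addrI/oppr_inj.
rewrite (@pcoefAt_pmul _ _ _ [seq q - u | u <- s]).
  by rewrite big_map; apply: eq_bigr => u _; rewrite mulrC subKr.
split=> [|v nz]; first by rewrite map_inj_uniq.
by apply/mapP; exists (q - v); rewrite ?subKr // cs // subKr mulrC.
Qed.

(** Exponents share a denominator and are bounded above, so an exponent at least [b] has bounded
    index. *)
Lemma pcoefAt_finite_above (x : pser) (b : rat) : exists s : seq rat,
  forall u, b <= u -> pcoefAt x u != 0 -> u \in s.
Proof.
have [K ltK] : exists K : nat, (ptop x)%:~R - b * (pN x)%:R < K%:R.
  eexists; exact: le_lt_trans (ler_norm _) (archi_boundP (normr_ge0 _)).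
exists [seq pexp (ptop x) (pN x) i | i <- iota 0 K] => u le /pcoefAt_neq0[k e].
apply/mapP; exists k => //; rewrite mem_iota /= add0n.
have : b * (pN x)%:R <= u * (pN x)%:R by rewrite ler_pM2r ?ltr0n.
rewrite e pexp_mulK // intrB -pmulrn => le'.
by rewrite -(ltr_nat rat); lra.
Qed.

Lemma pcoefAt_pmul_neq0 (x y : pser) (q : rat) : pcoefAt (pmul x y) q != 0 ->
  exists u, pcoefAt x u != 0 /\ pcoefAt y (q - u) != 0.
Proof.
move=> nz; apply: NNPP => no; move: nz.
rewrite (@pcoefAt_pmul x y q [::]) ?big_nil ?eqxx //; split=> // u.
by rewrite mulf_eq0 negb_or => /andP[xu yu]; case: no; exists u.
Qed.

(** Both coefficients at [q] become one double sum over finite lists, and the order of summation is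
    exchanged. *)
Lemma pmulA (x y z : pser) : peq (pmul (pmul x y) z) (pmul x (pmul y z)).
Proof.
move=> q.
pose mx x := pexp (ptop x) (pN x) 0.
(* In a nonzero triple product with exponents adding up to [q], the other two exponents are at most
   [mx y] and [mx z], which bounds that of [x] from below. *)
have [U covU] := pcoefAt_finite_above x (q - mx y - mx z).
have [V covV] := pcoefAt_finite_above y (q - mx x - mx z).
pose S := undup [seq u + v | u <- U, v <- V].
have supp u v : pcoefAt x u != 0 -> pcoefAt y v != 0 -> pcoefAt z (q - u - v) != 0 ->
    u \in undup U /\ u + v \in S.
  move=> xu yv zq; have /= := pcoefAt_top xu; have /= := pcoefAt_top yv.
  have /= := pcoefAt_top zq; rewrite -!/(mx _) => lz ly lx.
  have uU : u \in U by apply: covU => //; lra.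
  have vV : v \in V by apply: covV => //; lra.
  by rewrite !mem_undup uU; split=> //; apply/allpairsP; exists (u, v).
rewrite (@pcoefAt_pmul _ _ _ S); last first.
  split=> [|w]; first exact: undup_uniq.
  rewrite mulf_eq0 negb_or => /andP[/pcoefAt_pmul_neq0[u [xu yu]] zw].
  have [|_] := supp u (w - u) xu yu; last by rewrite addrC subrK.
  by rewrite (_ : q - u - (w - u) = q - w) //; ring.
rewrite (@pcoefAt_pmul _ _ _ (undup U)); last first.
  split=> [|u]; first exact: undup_uniq.
  rewrite mulf_eq0 negb_or => /andP[xu /pcoefAt_pmul_neq0[v [yv zv]]].
  by have [] := supp u v xu yv zv.
transitivity (\sum_(w <- S) \sum_(u <- undup U)
    pcoefAt x u * pcoefAt y (w - u) * pcoefAt z (q - w)).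
  apply: eq_bigr => w _; rewrite -mulr_suml.
  have [->|zw] := eqVneq (pcoefAt z (q - w)) 0; first by rewrite !mulr0.
  congr (_ * _); apply: pcoefAt_pmul; split=> [|u]; first exact: undup_uniq.
  rewrite mulf_eq0 negb_or => /andP[xu yu].
  have [|//] := supp u (w - u) xu yu.
  by rewrite (_ : q - u - (w - u) = q - w) //; ring.
rewrite exchange_big /=; apply: eq_bigr => u _.
under eq_bigr => w _ do rewrite -mulrA.
rewrite -mulr_sumr; have [->|xu] := eqVneq (pcoefAt x u) 0; first by rewrite !mul0r.
congr (_ * _); rewrite (@pcoefAt_pmul _ _ _ [seq w - u | w <- S]).
  by rewrite big_map; apply: eq_bigr => w _; congr (_ * pcoefAt z _); ring.
split=> [|v]; first by rewrite map_inj_uniq ?undup_uniq // => w w' /addIr.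
rewrite mulf_eq0 negb_or => /andP[yv zv]; have [_ vS] := supp u v xu yv zv.
by apply/mapP; exists (u + v) => //; rewrite addrC addKr.
Qed.

Lemma pcoefAt_pneg (x : pser) (q : rat) : pcoefAt (pneg x) q = - pcoefAt x q.
Proof. by rewrite /pcoefAt /pneg /pN /=; case: ifP => _; rewrite ?oppr0. Qed.

Lemma pmulBr (x y z : pser) :
  peq (pmul x (padd y (pneg z))) (padd (pmul x y) (pneg (pmul x z))).
Proof.
move=> q; rewrite pcoefAt_padd pcoefAt_pneg.
have [s [[us cs] ey]] := pcoefAt_pmul_cover x y q.
have [s' [[us' cs'] ez]] := pcoefAt_pmul_cover x z q.
(* Merging the covers lets all three convolutions run over one list. *)
pose S := undup (s ++ s').
have cov w : w \in s \/ w \in s' -> w \in S.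
  by rewrite mem_undup mem_cat => -[]->; rewrite ?orbT.
rewrite !(@pcoefAt_pmul _ _ _ S); try by (split; first exact: undup_uniq);
  move=> u nz; apply: cov; by [left; apply: cs | right; apply: cs'].
  rewrite -sumrB; apply: eq_bigr => u _.
  by rewrite pcoefAt_padd pcoefAt_pneg mulrBr.
split=> [|u]; first exact: undup_uniq.
rewrite pcoefAt_padd pcoefAt_pneg mulrBr => nz; apply: cov.
have [y0|/cs] := eqVneq (pcoefAt x u * pcoefAt y (q - u)) 0; last by left.
by right; apply: cs'; move: nz; rewrite y0 sub0r oppr_eq0.
Qed.

Lemma pmulACA (x y z w : pser) :
  peq (pmul (pmul x y) (pmul z w)) (pmul (pmul x z) (pmul y w)).
Proof.
apply: peq_trans (pmulA _ _ _) (peq_trans _ (peq_sym (pmulA _ _ _))).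
apply: peq_pmul => //; apply: peq_trans (peq_sym (pmulA _ _ _)) _.
apply: peq_trans (pmulA _ _ _); exact: peq_pmul (pmulC _ _) _.
Qed.

Lemma pdet_kscale (lam : pser) (A : KMat) :
  peq (pdet (kscale lam A)) (pmul (pmul lam lam) (pdet A)).
Proof.
move=> q; rewrite pmulBr !pcoefAt_padd !pcoefAt_pneg.
by congr (_ - _); apply: pmulACA.
Qed.

(** * Leading terms of series *)

(* [c] may vanish: [a] is then only an upper bound for the order of [x]. *)
Definition leads (x : pser) (a : rat) (c : C) : Prop :=
  (forall q, a < q -> pcoefAt x q = 0) /\ pcoefAt x a = c.

Lemma leads_peq (x y : pser) (a : rat) (c : C) : peq x y -> leads x a c -> leads y a c.
Proof. by move=> e [lx ex]; split=> [q /lx|]; rewrite -e. Qed.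

Lemma leads_pzero (x : pser) (a : rat) : pzero x -> leads x a 0.
Proof. by move=> x0; split. Qed.

(** Exponents decrease with the index, so the least index with a nonzero coefficient gives the
    order. *)
Lemma leads_exists (x : pser) : ~ pzero x -> exists a c, leads x a c /\ c != 0.
Proof.
move=> nz; have ex : exists k, pcoef x k != 0.
  apply: NNPP => no; apply: nz => q.
  have [[k [_ ->]]|[_ ->]] := pcoefAt_cases x q => //.
  by apply/eqP/negPn/negP => k0; apply: no; exists k.
case: (ex_minnP ex) => m m0 mmin; exists (pexp (ptop x) (pN x) m), (pcoef x m).
split=> //; split=> [q lt|]; last exact: pcoefAt_pexp.
have [[k [e ->]]|[_ ->]] := pcoefAt_cases x q => //.
apply/eqP/negPn/negP => /mmin mk; move: lt; rewrite e /pexp.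
by rewrite ltr_pM2r ?invr_gt0 ?ltr0n // ltr_int; lia.
Qed.

Lemma leads_top (x : pser) : leads x (pexp (ptop x) (pN x) 0) (pcoef x 0).
Proof.
split=> [q lt|]; last exact: pcoefAt_pexp.
by apply/eqP/negPn/negP => /pcoefAt_top; rewrite leNgt lt.
Qed.

Lemma leads_pconst (c : C) : leads (pconst c) 0 c.
Proof. by have := leads_top (pconst c); rewrite /pexp mul0r. Qed.

Lemma leads_ptpow (q : rat) : leads (ptpow q) q 1.
Proof.
have := leads_top (ptpow q); rewrite /pexp /= pN_PSer ?absz_gt0 ?denq_neq0 //.
by rewrite subr0 pmulrn absz_denq divq_num_den.
Qed.

Lemma leads_padd (x y : pser) (a : rat) (c d : C) :
  leads x a c -> leads y a d -> leads (padd x y) a (c + d).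
Proof.
move=> [lx <-] [ly <-]; split=> [q aq|]; rewrite pcoefAt_padd //.
by rewrite lx ?ly ?addr0.
Qed.

Lemma leads_pneg (x : pser) (a : rat) (c : C) : leads x a c -> leads (pneg x) a (- c).
Proof.
move=> [lx <-]; split=> [q aq|]; rewrite pcoefAt_pneg //.
by rewrite lx ?oppr0.
Qed.

Lemma leads_pmul (x y : pser) (a b : rat) (c d : C) :
  leads x a c -> leads y b d -> leads (pmul x y) (a + b) (c * d).
Proof.
move=> [lx <-] [ly <-].
have supp u : pcoefAt x u != 0 -> u <= a.
  by move=> xu; rewrite leNgt; apply/negP => /lx e; rewrite e eqxx in xu.
have supp' u : pcoefAt y u != 0 -> u <= b.
  by move=> yu; rewrite leNgt; apply/negP => /ly e; rewrite e eqxx in yu.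
split=> [q lt|].
  apply/eqP/negPn/negP => /pcoefAt_pmul_neq0[u [/supp xu /supp' yu]]; lra.
(* From [u <= a] and [a + b - u <= b] only [u = a] can contribute. *)
rewrite (@pcoefAt_pmul _ _ _ [:: a]) ?big_seq1 ?[a + b]addrC ?addrK //.
split=> // u; rewrite mulf_eq0 negb_or inE => /andP[/supp xu /supp' yu].
by apply/eqP; lra.
Qed.

Lemma leads_ppow (x : pser) (a : rat) (c : C) (k : nat) :
  leads x a c -> leads (ppow x k) (k%:R * a) (c ^+ k).
Proof.
move=> lx; elim: k => [|k IH]; first by rewrite mul0r; exact: leads_pconst.
by rewrite mulrSr mulrDl mul1r addrC exprS; exact: leads_pmul.
Qed.

Lemma leads_pprod (I : Type) (s : seq I) (x : I -> pser) (e : I -> rat) (c : I -> C) :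
  (forall i, leads (x i) (e i) (c i)) ->
  leads (foldr pmul pone [seq x i | i <- s]) (\sum_(i <- s) e i) (\prod_(i <- s) c i).
Proof.
move=> lx; elim: s => [|i s IH] /=; first by rewrite !big_nil; exact: leads_pconst.
by rewrite !big_cons; exact: leads_pmul.
Qed.

Lemma pcoefAt_psum (s : seq pser) (q : rat) :
  pcoefAt (psum s) q = \sum_(x <- s) pcoefAt x q.
Proof.
elim: s => [|x s IH] /=; last by rewrite big_cons pcoefAt_padd IH.
rewrite big_nil /pcoefAt /=; case: ifP => // _; by case: ifP.
Qed.

(** By homogeneity every monomial has the same bound [d * a] on its order, so the coefficients there
    add up to the value of [f]. *)
Lemma leads_peval (d : nat) (f : {mpoly C[4]}) (v : 'I_4 -> pser) (a : rat) (w : 'I_4 -> C) :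
  homog_deg d f -> (forall k, leads (v k) a (w k)) ->
  leads (peval f v) (d%:R * a) f.@[w].
Proof.
move=> hf lv.
have lm m : m \in msupp f -> leads (pmul (pconst f@_m)
    (foldr pmul pone [seq ppow (v i) (m i) | i <- enum 'I_4]))
    (d%:R * a) (f@_m * \prod_i w i ^+ m i).
  move=> mf; have := leads_pmul (leads_pconst f@_m) (leads_pprod (enum 'I_4)
    (fun i => leads_ppow (m i) (lv i))).
  by rewrite add0r -mulr_suml !big_enum /= -natr_sum -mdegE hf.
split=> [q lt|]; rewrite pcoefAt_psum big_map ?mevalE; last first.
  by apply: eq_big_seq => m /lm[].
by rewrite big1_seq // => m /andP[_ /lm[lz _]]; apply: lz.
Qed.

(** * Homogeneous scaling and leading terms of matrices *)

Lemma evalC_scale (d : nat) (f : {mpoly C[4]}) (k : C) (B : 'M[C]_2) :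
  homog_deg d f -> evalC f (k *: B) = k ^+ d * evalC f B.
Proof.
move=> hf; rewrite /evalC !mevalE mulr_sumr; apply: eq_big_seq => m mf.
rewrite mulrCA; congr (_ * _); rewrite -(hf m mf) mdegE -prodrXr -big_split /=.
by apply: eq_bigr => i _; rewrite /vec_of mxE exprMn.
Qed.

Lemma det_mx2 (R : comNzRingType) (B : 'M[R]_2) : \det B = B 0 0 * B 1 1 - B 0 1 * B 1 0.
Proof.
rewrite (expand_det_row _ 0) !big_ord_recl big_ord0 /cofactor !det_mx11 !mxE /=.
rewrite /= expr0 expr1 mul1r addr0 mulN1r mulrN.
by congr (_ * B _ _ - B _ _ * B _ _); apply: val_inj.
Qed.

Definition mleads (A : KMat) (a : rat) (B : 'M[C]_2) : Prop :=
  forall i j, leads (A i j) a (B i j).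

Lemma lead_term_mleads (A : KMat) (a : rat) (B : 'M[C]_2) : lead_term A a B -> mleads A a B.
Proof. by move=> [_ [eB zB]] i j; split=> // q; exact: zB. Qed.

Lemma leads_pdet (A : KMat) (a : rat) (B : 'M[C]_2) :
  mleads A a B -> leads (pdet A) (a + a) (\det B).
Proof.
move=> lA; rewrite det_mx2; apply: leads_padd; last apply: leads_pneg; exact: leads_pmul.
Qed.

(** * The top coefficient of the defining equation *)

(** Each [e j] bounds the order of the [j]-th summand, so only those with [e j = E] reach [E]. The
    bound [dl] is independent of [a], to allow for a determinant whose order drops below [a + a]. *)
Lemma pcoefAt_Fpol (n : nat) (f : nat -> {mpoly C[4]}) (A : KMat)
    (a dl : rat) (B : 'M[C]_2) (d : C) (E : rat) :
  let e j := - (j * j.+1)%:R + ((n - j)%:R * dl + j.*2.+1%:R * a) in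
  (forall j, (j <= n)%N -> homog_deg j.*2.+1 (f j)) ->
  mleads A a B -> leads (pdet A) dl d ->
  (forall j, (j <= n)%N -> e j <= E) ->
  pcoefAt (Fpol n f A) E =
    \sum_(j < n.+1 | e j == E) d ^+ (n - j) * evalC (f j) B.
Proof.
move=> e hf lA ld leE; rewrite pcoefAt_psum big_map -[iota 0 _]/(index_iota 0 n.+1) big_mkord.
rewrite [RHS]big_mkcond; apply: eq_bigr => -[j /= jn] _.
have [lz ez] := leads_pmul (leads_ptpow (- (j * j.+1)%N%:R)) (leads_pmul
  (leads_ppow (n - j) ld) (leads_peval (hf j jn) (fun k => lA (inord (k %/ 2)) (inord (k %% 2))))).
case: eqVneq => [<-|ne]; first by rewrite ez mul1r.
by apply: lz; rewrite lt_neqAle ne leE.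
Qed.

(** Division without inverses: if the true order of [y] exceeded [b - a], the product would have a
    nonzero coefficient above [b]. *)
Lemma leads_pmul_inv (x y : pser) (a b : rat) (c d : C) :
  leads x a c -> c != 0 -> leads (pmul x y) b d -> leads y (b - a) (c^-1 * d).
Proof.
move=> lx c0 lxy.
have low q : b - a < q -> pcoefAt y q = 0.
  have [y0|/leads_exists[b' [d' [ly d'0]]]] := classic (pzero y); first by [].
  move=> lt; apply: ly.1; apply: le_lt_trans lt; rewrite lerBrDl leNgt.
  apply/negP => /(lxy.1) /eqP; rewrite (leads_pmul lx ly).2.
  by rewrite (negbTE (mulf_neq0 c0 d'0)).
split=> //; have := (leads_pmul lx (conj low erefl)).2.
by rewrite subrKC lxy.2 => ->; rewrite mulKf.
Qed.

Lemma mleads_kscale_inv (lam : pser) (A : KMat) (l a : rat) (c : C) (B : 'M[C]_2) :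
  leads lam l c -> c != 0 -> mleads (kscale lam A) a B -> mleads A (a - l) (c^-1 *: B).
Proof. by move=> ll c0 lA i j; rewrite mxE; exact: leads_pmul_inv ll c0 (lA i j). Qed.

(* Rescaling [A] by [lam ~ c t^l] multiplies [Fpol n f A] by [lam^(2n+1)], so
   the top coefficients of both differ by the shift [(2n+1) l] and the factor
   [c^(2n+1)]. *)
Lemma sum_top_eq0 (n : nat) (f : nat -> {mpoly C[4]}) (A : KMat) (lam : pser)
    (a : rat) (B : 'M[C]_2) (E : rat) :
  let e j := j.*2.+1%:R * a - (j * j.+1)%:R in
  (forall j, (j <= n)%N -> homog_deg j.*2.+1 (f j)) ->
  pzero (Fpol n f A) -> peq (pdet (kscale lam A)) pone ->
  lead_term (kscale lam A) a B ->
  (forall j, (j <= n)%N -> e j <= E) ->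
  \sum_(j < n.+1 | e j == E) evalC (f j) B = 0.
Proof.
move=> e hf F0 det1 lt leE; have lA := lead_term_mleads lt.
have [l [c [ll c0]]] : exists l c, leads lam l c /\ c != 0.
  (* If [lam] were zero, so would be [kscale lam A], against [B != 0]. *)
  apply: leads_exists => lam0; apply: (elimN eqP lt.1); apply/matrixP => i j.
  rewrite mxE -(lA i j).2.
  apply/eqP/negPn/negP => /pcoefAt_pmul_neq0[u [+ _]].
  by rewrite lam0 eqxx.
(* Read off from [lam^2 * det A = 1]. *)
have ldet : leads (pdet A) (0 - (l + l)) ((c * c)^-1 * 1).
  apply: (leads_pmul_inv (leads_pmul ll ll)); first exact: mulf_neq0.
  apply: leads_peq (leads_pconst 1) => q.
  by rewrite -pdet_kscale det1.
(* The shift is the same for all [j] because [2(n-j) + (2j+1) = 2n+1]. *)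
have eE j : (j <= n)%N ->
    - (j * j.+1)%:R + ((n - j)%:R * (0 - (l + l)) + j.*2.+1%:R * (a - l)) =
    e j - n.*2.+1%:R * l.
  move=> jn; rewrite /e natrB // -!addnn !natrM -!natr1 !natrD; ring.
have := pcoefAt_Fpol hf (mleads_kscale_inv ll c0 lA) ldet (E := E - n.*2.+1%:R * l).
rewrite F0 => /(_ _)/esym sum0.
have c'0 : c^-1 ^+ n.*2.+1 != 0 by rewrite expf_neq0 // invr_eq0.
apply: (mulfI c'0); rewrite mulr0 mulr_sumr -[RHS]sum0; last first.
  by move=> j jn; rewrite eE // lerD2r leE.
apply: eq_big => [[j jn]|[j jn] _] /=; first by rewrite eE // (inj_eq (addIr _)).
rewrite (evalC_scale _ _ (hf j jn)) mulrA mulr1 invfM -expr2 -exprM -exprD.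
by congr (_ ^+ _ * _); rewrite ltnS in jn; lia.
Qed.

Lemma degenerate_eq0 (n : nat) (f : nat -> {mpoly C[4]}) (A : KMat) (a : rat) (B : 'M[C]_2) :
  (forall j, (j <= n)%N -> homog_deg j.*2.+1 (f j)) ->
  pzero (Fpol n f A) -> pzero (pdet A) -> mleads A a B -> evalC (f n) B = 0.
Proof.
move=> hf F0 det0 lA.
(* As [det A = 0], any number bounds its order; this one puts the [n]-th term on top. *)
have ldet := leads_pzero (a + a - n.*2.+1%:R) det0.
have := pcoefAt_Fpol hf lA ldet (E := n.*2.+1%:R * a - (n * n.+1)%:R).
rewrite F0 => /(_ _)/esym; rewrite big_mkcond big_ord_recr /= subnn mulr0n mul0r add0r.
(* For [j < n] the factor [0 ^+ (n - j)] kills the summand, leaving [j = n]. *)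
rewrite [- _ + _]addrC eqxx expr0 mul1r big1 ?add0r => [-> // j jn|[j jn] _ /=]; last first.
  by rewrite expr0n subn_eq0 leqNgt jn mul0r; case: ifP.
(* With [n = j + k], the bound for the [j]-th summand lies [k^2] below that for the [n]-th. *)
have [k ->] : exists k, n = (j + k)%N by exists (n - j)%N; lia.
rewrite addKn -!addnn !natrM -!natr1 !natrD.
have : 0 <= k%:R * (j%:R + k%:R) :> rat by rewrite mulr_ge0 ?addr_ge0.
by nra.
Qed.

(** * Position of [a] and comparison of exponents *)

Lemma trichotomy (n : nat) (a : rat) : 0 < a ->
  [\/ exists2 j, (j < n)%N & j%:R < a < j.+1%:R,
      exists2 j, (1 <= j <= n)%N & a = j%:R | n%:R < a].
Proof.
move=> a0; elim: n => [|n [[j jn ja]|[j jn ja]|na]]; first by constructor 3.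
- by constructor 1; exists j => //; lia.
- by constructor 2; exists j => //; lia.
have [lt|gt|eq] := ltgtP a n.+1%:R; first by constructor 1; exists n; rewrite ?na.
  by constructor 3.
by constructor 2; exists n.+1; rewrite ?leqnn.
Qed.

Lemma exponent_diff (a : rat) (i j : nat) :
  (j.*2.+1%:R * a - (j * j.+1)%:R) - (i.*2.+1%:R * a - (i * i.+1)%:R) =
  (j%:R - i%:R) * (2 * a - j%:R - i%:R - 1).
Proof. rewrite -!addnn !natrM -!natr1 !natrD; ring. Qed.

Lemma eexp0 : eexp 0 = 1.
Proof. by rewrite /eexp rmorph0 expR0. Qed.

(** * Locating the valuation in the four sets *)

Theorem theorem5p2 (n : nat) (f : nat -> {mpoly C[4]}) :
  (1 <= n)%N ->
  (forall j, (j <= n)%N -> homog_deg j.*2.+1 (f j) /\ ~ dvd_det (f j)) ->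
  forall A : KMat, knonzero A -> pzero (Fpol n f A) ->
  VAL_in (fun M => Sigma_inf n f M \/ Sigma_R n f M \/ Sigma_C n f M \/ Sigma_0 f M) A.
Proof.
move=> n1 hf A A0 F0; have {}hf j jn := (hf j jn).1; split=> [det0 a B lt|_ lam det1 a B lt].
  left; exists 1; split; first exact: oner_neq0.
  exists B; rewrite scale1r; have lA := lead_term_mleads lt; split=> //; split.
    split; first exact: lt.1.
    by rewrite -(leads_pdet lA).2.
  exact: degenerate_eq0 lA.
have ldet : leads pone (a + a) (\det B).
  exact: leads_peq det1 (leads_pdet (lead_term_mleads lt)).
have lone : leads pone 0 1 := leads_pconst 1.
(* Otherwise [0] lies above [a + a], and the coefficient 1 of [pone] there would vanish. *)
have a_ge0 : 0 <= a.
  rewrite leNgt; apply/negP => a0; have := ldet.1 0.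
  rewrite lone.2 => e; have := oner_neq0 C; rewrite e ?eqxx //; lra.
pose e j : rat := j.*2.+1%:R * a - (j * j.+1)%:R.
(* A strict maximum leaves a single summand in [sum_top_eq0]. *)
have unique_top J : (J <= n)%N ->
    (forall j, (j <= n)%N -> j <> J -> e j < e J) -> evalC (f J) B = 0.
  move=> Jn lte; have := sum_top_eq0 hf F0 det1 lt (E := e J).
  rewrite (big_pred1 (Ordinal (Jn : (J < n.+1)%N))) => [-> // j jn|[j jn]] /=.
    by have [->|/eqP ne] := eqVneq j J; rewrite ?lexx // ltW // lte.
  rewrite -[RHS]val_eqE /=; apply/eqP/eqP => [|->//].
  by have [//|/eqP ne] := eqVneq j J => ej; have := lte j jn ne; rewrite /e ej ltxx.
case: (ltgtP 0 a) a_ge0 => // [a0|a0] _; last first.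
  right; right; right; exists B.
  (* For [a = 0], [\det B] is the coefficient of [pone] at 0. *)
  have detB : \det B = 1 by rewrite -lone.2 -[in LHS]ldet.2 -a0 addr0.
  rewrite detB oner_neq0; split=> //; split.
    apply: unique_top => // -[//|j] _ _; rewrite /e -a0 !mulr0 !sub0r ltrN2.
    by rewrite ltr_nat.
  exists B; split; first by exists 1; rewrite oner_neq0 scale1r.
  split=> //; exists 1; rewrite oner_neq0 scale1r; split=> //.
  by rewrite /cone_pt -a0 oppr0 eexp0 !scale1r.
(* Now [a + a > 0], where [pone] has coefficient 0. *)
have rB : rank1 B.
  by split; [exact: lt.1 | rewrite -ldet.2; apply: lone.1; lra].
have in_cone I T : I a -> T B -> cone I T (cone_pt a B).
  move=> Ia TB; exists a; split=> //; exists B; do 2!split=> //.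
  by exists 1; rewrite oner_neq0 scale1r.
have natD i j : (i < j)%N -> i%:R + 1 <= j%:R :> rat.
  by move=> ij; rewrite natr1 ler_nat.
(* The two alternatives make both factors of [exponent_diff] positive, or both negative. *)
have lt_e i J : ((i < J)%N /\ J%:R + i%:R + 1 < 2 * a) \/
    ((J < i)%N /\ 2 * a < J%:R + i%:R + 1) -> e i < e J.
  move=> h; rewrite -subr_gt0 exponent_diff.
  case: h => -[/natD iJ ?]; first by apply: mulr_gt0; lra.
  by rewrite -mulrNN; apply: mulr_gt0; lra.
case: (trichotomy n a0) => [[J Jn /andP[Ja aJ]]|[J /andP[J1 Jn] Ja]|na].
- right; left; left; exists J; split=> //; apply: in_cone; first by rewrite Ja aJ.
  split=> //; apply: unique_top => [|j jn /eqP]; first exact: ltnW.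
  rewrite neq_ltn -natr1 in aJ * => /orP[lt'|lt']; apply: lt_e; [left|right]; split=> //;
    have := natD _ _ lt'; lra.
- right; right; left; exists J; rewrite J1 Jn; split=> //; apply: in_cone => //.
  (* For [a = J] the second factor [2J - J - (J-1) - 1] is zero. *)
  have eJ : e J.-1 = e J.
    apply/eqP; rewrite -subr_eq0 exponent_diff Ja; case: J J1 {Jn Ja} => // J _ /=.
    by rewrite -natr1; apply/eqP; ring.
  have le_e j : (j <= n)%N -> j <> J -> j <> J.-1 -> e j < e J.
    move=> jn /eqP nJ /eqP nJ'; apply: lt_e; rewrite Ja.
    move: nJ; rewrite neq_ltn => /orP[lt'|lt']; [left|right]; split=> //; last first.
      by have := natD _ _ lt'; lra.
    (* Excluding [J.-1] is what makes [J + j + 1 < 2J] strict. *)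
    have lt2 : (j.+1 < J)%N by lia.
    by have := natD _ _ lt2; rewrite -natr1; lra.
  have : evalC (f J.-1) B + evalC (f J) B = 0.
    have := sum_top_eq0 hf F0 det1 lt (E := e J).
    have J'n : (J.-1 < n.+1)%N by lia.
    have Jn' : (J < n.+1)%N by lia.
    rewrite (bigD1 (Ordinal J'n)) /= -/(e _) ?eJ //.
    rewrite (big_pred1 (Ordinal Jn')) => [-> // j jn|[j jn]] /=.
      have [->|/eqP ne] := eqVneq j J; first by rewrite lexx.
      have [->|/eqP ne'] := eqVneq j J.-1; first by rewrite -/(e _) eJ lexx.
      by rewrite ltW // le_e.
    rewrite -[RHS]val_eqE -[X in _ && ~~ X]val_eqE /= -/(e _).
    have [->|/eqP ne] := eqVneq j J; first by rewrite eqxx; apply/eqP; lia.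
    have [->|/eqP ne'] := eqVneq j J.-1; first by rewrite andbF.
    by rewrite lt_eqF ?le_e.
  move=> /eqP; rewrite addr_eq0 => /eqP fJ.
  (* Either both values vanish and [B] lies over the intersection of the curves, or
     [-f_{2J-1}(B)/f_{2J+1}(B) = 1], so the square root [s = 1] shows that [B] itself represents the
     section. *)
  have [z|nz] := eqVneq (evalC (f J) B) 0.
    by right; split; split=> //; rewrite fJ z oppr0.
  left; exists B; split=> //; split; first by rewrite fJ oppr_eq0.
  split=> //; exists 1; split; first by rewrite fJ mulNr divff // opprK expr1n.
  by exists 1; rewrite oner_neq0 !scale1r; split.
right; left; right; apply: in_cone => //; split=> //.
(* Only smaller indices compete with [n], and [n + j + 1 <= 2n < 2a]. *)
apply: unique_top => // j jn /eqP ne; apply: lt_e; left.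
have lt' : (j < n)%N by lia.
by split=> //; have := natD _ _ lt'; lra.
Qed.
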